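(* Let $\Sigma$ be a signature and $\mathcal{R}$ a term rewriting system over $\Sigma$. The relation $\twoheadrightarrow_{\mathit{nest}}$ (derivability by a proof tree without infinite nesting of $\rightharpoondown^{<}$, as in the context) coincides with the relation $$\twoheadrightarrow_{\mathit{fp}} \;=\; \mu x.\,\nu y.\,(\to_{\varepsilon} \cup \overline{x})^* \circ \overline{y},$$ where $\mu$ and $\nu$ denote least and greatest fixed points in the complete lattice $\mathcal{P}(T\times T)$ ordered by inclusion.
   Context: Let $\Sigma$ be a signature, $\mathcal{X}$ an infinite set of variables, and $T$ the set of finite and infinite terms over $\Sigma$ and $\mathcal{X}$. A term rewriting system $\mathcal{R}$ is a set of pairs $\ell \to r$ of (possibly infinite) terms with $\ell$ not a variable and every variable of $r$ occurring in $\ell$. Root steps: $\to_{\varepsilon} = \{(\ell\sigma, r\sigma) \mid \ell\to r \in \mathcal{R},\ \sigma \text{ a substitution}\}$. For $R \subseteq T\times T$ its lifting is $\overline{R} = \{(f(s_1,\ldots,s_n), f(t_1,\ldots,t_n)) \mid f\in\Sigma,\ s_1 \mathrel{R} t_1, \ldots, s_n \mathrel{R} t_n\} \cup \mathrm{id}$, where $\mathrm{id}$ is the identity relation on $T$; $R^*$ is reflexive–transitive closure and $\circ$ is relational composition ($s \mathrel{(A\circ B)} t$ iff $s \mathrel{A} u \mathrel{B} t$ for some $u$). The map $(x,y)\mapsto(\to_{\varepsilon} \cup \overline{x})^* \circ \overline{y}$ is monotone in both arguments, so the fixed points exist. Judgements $s \twoheadrightarrow t$, $s \rightharpoondown t$,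 $s \rightharpoondown^{<} t$; proof trees are finite or infinite (not necessarily well-founded) trees built from the coinductive rules: (split) a node $s \twoheadrightarrow t$ has as premises a finite sequence $s = u_0, \ldots, u_k$ with each consecutive pair either a root step $u_i \to_{\varepsilon} u_{i+1}$ (a leaf) or a node $u_i \rightharpoondown^{<} u_{i+1}$, followed by a node $u_k \rightharpoondown t$; (lift) a node $f(s_1,\ldots,s_n) \rightharpoondown f(t_1,\ldots,t_n)$ or $f(s_1,\ldots,s_n) \rightharpoondown^{<} f(t_1,\ldots,t_n)$ has premises $s_i \twoheadrightarrow t_i$ for $i=1,\ldots,n$; (id) $s \rightharpoondown s$ and $s \rightharpoondown^{<} s$ are axioms. $s \twoheadrightarrow_{\mathit{nest}} t$ holds iff there is such a proof tree deriving $s \twoheadrightarrow t$ in which no ascending path meets infinitely many $\rightharpoondown^{<}$-nodes. *)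

(* Defs.v *)
From mathcomp Require Import all_boot.
From Stdlib Require Import Relations FunctionalExtensionality.
From Stdlib Require FinFun.

Set Implicit Arguments.
Unset Strict Implicit.
Unset Printing Implicit Defensive.

Record signature := Signature { symbol :> Type; arity : symbol -> nat }.

Definition infinite (X : Type) : Prop := ~ FinFun.Finite X.

(* A finite or infinite term is a labelled tree: a partial map from positions
   (finite sequences of argument indices, counted from 0) to labels.  With this
   encoding Leibniz equality is equality of trees (lemma term_ext), which fails
   for a plain coinductive type of terms. *)
Section Terms.
Variables (Sig : signature) (X : Type).

Definition labelling := seq nat -> option (Sig + X).

(* Position p.i carries a label iff p carries a symbol of arity > i. *)
Definition arity_respecting (l : labelling) : Prop :=
  forall p i,
    isSome (l (rcons p i)) = if l p is Some (inl f) then i < arity f else false.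

Record term := Term {
  label :> seq nat -> option (Sig + X);
  term_root : isSome (label [::]);
  term_arity : arity_respecting label }.

Lemma term_ext (s t : term) : (forall p, s p = t p) -> s = t.
Proof.
case: s t => [l lr la] [l' lr' la'] /= /functional_extensionality e.
case: l' / e lr' la' => lr' la'.
rewrite (bool_irrelevance lr lr'); congr Term.
apply: functional_extensionality_dep => p.
by apply: functional_extensionality_dep => i; apply: eq_irrelevance.
Qed.

Definition var_labelling (x : X) : labelling :=
  fun p => if p is [::] then Some (inr x) else None.

Lemma var_arity x : arity_respecting (var_labelling x).
Proof. by case=> [|j p] i. Qed.

Definition var (x : X) : term := @Term (var_labelling x) isT (@var_arity x).

Definition app_labelling (f : Sig) (a : 'I_(arity f) -> term) : labelling :=
  fun p => match p with
    | [::] => Some (inl f)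
    | i :: q => if (insub i : option 'I_(arity f)) is Some j then a j q else None
    end.

Lemma app_arity f (a : 'I_(arity f) -> term) :
  arity_respecting (app_labelling a).
Proof.
case=> [|j p] i /=; last by case: insub => // k; apply: term_arity.
case: insubP => [k -> _|/negbTE -> //]; exact: term_root.
Qed.

(* The term f(a_0, ..., a_(n-1)), where n is the arity of f. *)
Definition app (f : Sig) (a : 'I_(arity f) -> term) : term :=
  @Term (app_labelling a) isT (@app_arity f a).

Lemma term_case (t : term) :
  (exists x, t = var x) \/ (exists f a, t = @app f a).
Proof.
have nolab (l : labelling) p : arity_respecting l -> l [::] = None -> l p = None.
  move=> la l0; elim/last_ind: p => // p i IHp.
  by move: (la p i); rewrite IHp; case: (l _).
have shift (l : labelling) i : arity_respecting l ->
    arity_respecting (fun p => l (i :: p)).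
  by move=> la p j; rewrite -(la (i :: p)).
case: t => l lr la.
case l0: (l [::]) => [[f|x]|]; last by exfalso; move: lr; rewrite l0.
- right; exists f.
  have kid (i : 'I_(arity f)) : isSome (l [:: val i]).
    by rewrite (la [::]) l0 ltn_ord.
  exists (fun i => Term (kid i) (shift l i la)); apply: term_ext => -[|i p] //=.
  case: insubP => [j _ <- //|lt_i].
  apply: (nolab _ _ (shift l i la)).
  by move: (la [::] i); rewrite l0 (negbTE lt_i) /=; case: (l _).
- left; exists x; apply: term_ext => -[|i p] //=.
  apply: (nolab _ _ (shift l i la)).
  by move: (la [::] i); rewrite l0 /=; case: (l _).
Qed.

Definition occurs (x : X) (t : term) : Prop := exists p, t p = Some (inr x).

(* Walk along p from the root; once a variable x is met, continue in sigma x. *)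
Fixpoint subst_labelling (sigma : X -> term) (l : labelling) (p : seq nat) :=
  match l [::] with
  | Some (inr x) => sigma x p
  | l0 => if p is i :: q then subst_labelling sigma (fun r => l (i :: r)) q
          else l0
  end.

Lemma subst_root sigma (t : term) : isSome (subst_labelling sigma t [::]).
Proof.
rewrite /=; case t0: (t [::]) (term_root t) => [[f|x]|] // _.
exact: term_root.
Qed.

Lemma subst_arity sigma (l : labelling) :
  arity_respecting l -> arity_respecting (subst_labelling sigma l).
Proof.
move=> la p; elim: p l la => [|j p IHp] l la i /=.
  move: (la [::] i) => /=.
  case: (l [::]) => [[f|x]|] /=; last 1 first.
  - by case: (l [:: i]).
  - by move=> <-; case: (l [:: i]) => [[g|y]|] //; rewrite term_root.
  - by move=> _; rewrite -(term_arity (sigma x) [::]).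
have la' : arity_respecting (fun r => l (j :: r)).
  by move=> q k; rewrite -(la (j :: q)).
case: (l [::]) => [[f|x]|]; try exact: IHp.
by rewrite -(term_arity (sigma x) (j :: p)).
Qed.

Definition subst (sigma : X -> term) (t : term) : term :=
  @Term (subst_labelling sigma t) (subst_root sigma t)
        (subst_arity sigma (@term_arity t)).

Lemma subst_var sigma x : subst sigma (var x) = sigma x.
Proof. by apply: term_ext => -[]. Qed.

Lemma subst_app sigma f (a : 'I_(arity f) -> term) :
  subst sigma (app a) = app (fun i => subst sigma (a i)).
Proof.
apply: term_ext => -[|i p] //=; case: insub => //.
by elim: p.
Qed.

Inductive lifting (Q : relation term) : relation term :=
| lifting_app f (a b : 'I_(arity f) -> term) :
    (forall i, Q (a i) (b i)) -> lifting Q (app a) (app b)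
| lifting_id s : lifting Q s s.

End Terms.

Arguments var {Sig X} x.
Arguments app {Sig X} f a.

Record trs (Sig : signature) (X : Type) := Trs {
  rule : relation (term Sig X);
  rule_lhs : forall l r, rule l r -> forall x, l <> var x;
  rule_vars : forall l r, rule l r -> forall x, occurs x r -> occurs x l }.

Definition comp (A : Type) (P Q : relation A) : relation A :=
  fun s t => exists2 u, P s u & Q u t.

Section FixedPoints.
Variable A : Type.
Implicit Types (F : relation A -> relation A) (P Q : relation A).

Definition monotone F : Prop :=
  forall P Q, inclusion A P Q -> inclusion A (F P) (F Q).

Definition is_lfp F P : Prop :=
  same_relation A (F P) P /\
  forall Q, same_relation A (F Q) Q -> inclusion A P Q.

Definition is_gfp F P : Prop :=
  same_relation A (F P) P /\
  forall Q, same_relation A (F Q) Q -> inclusion A Q P.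

(* For a monotone F, mu F and nu F are the least and greatest fixed points of F
   (lemmas mu_lfp and nu_gfp). *)
Definition mu F : relation A :=
  fun s t => forall P, inclusion A (F P) P -> P s t.

Definition nu F : relation A :=
  fun s t => exists2 P, inclusion A P (F P) & P s t.

Lemma mu_lfp F : monotone F -> is_lfp F (mu F).
Proof.
move=> Fmono.
have pre : inclusion A (F (mu F)) (mu F).
  move=> s t st P FP; apply: (FP); apply: Fmono st => u v; exact.
split=> [|Q [FQ _] s t]; last by move=> st; apply: st.
by split=> // s t st; apply: st; apply: Fmono.
Qed.

Lemma nu_gfp F : monotone F -> is_gfp F (nu F).
Proof.
move=> Fmono.
have post : inclusion A (nu F) (F (nu F)).
  move=> s t [P PF st]; apply: Fmono (PF _ _ st) => u v uv; by exists P.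
split=> [|Q [_ QF] s t st]; last by exists Q.
by split=> // s t st; exists (F (nu F)) => //; apply: Fmono.
Qed.

Lemma nu_mono (F G : relation A -> relation A) :
  (forall P, inclusion A (F P) (G P)) -> inclusion A (nu F) (nu G).
Proof. by move=> FG s t [P PF st]; exists P => // u v uv; apply: FG (PF _ _ uv). Qed.

End FixedPoints.

Section Rewriting.
Variables (Sig : signature) (X : Type) (R : trs Sig X).
Notation T := (term Sig X).

Definition root_step : relation T :=
  fun s t => exists l r sigma,
    [/\ rule R l r, s = subst sigma l & t = subst sigma r].

Definition fp_step (x y : relation T) : relation T :=
  comp (clos_refl_trans T (union T root_step (lifting x))) (lifting y).

Definition rewrites_fp : relation T := mu (fun x => nu (fun y => fp_step x y)).

Lemma lifting_mono : monotone (@lifting Sig X).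
Proof.
move=> P Q PQ s t [f a b ab|u]; last exact: lifting_id.
by apply: lifting_app => i; apply: PQ.
Qed.

Lemma fp_step_mono x x' y y' :
  inclusion T x x' -> inclusion T y y' ->
  inclusion T (fp_step x y) (fp_step x' y').
Proof.
move=> xx' yy' s t [u su ut]; exists u; last exact: lifting_mono ut.
elim: su => [v w [vw|vw]|v|v w z _ vw _ wz].
- by apply: rt_step; left.
- by apply: rt_step; right; apply: lifting_mono vw.
- exact: rt_refl.
- exact: rt_trans vw wz.
Qed.

Lemma rewrites_fp_inner x : is_gfp (fp_step x) (nu (fp_step x)).
Proof. by apply: nu_gfp => y y' yy'; apply: fp_step_mono. Qed.

Lemma rewrites_fp_outer : is_lfp (fun x => nu (fp_step x)) rewrites_fp.
Proof.
by apply: mu_lfp => x x' xx'; apply: nu_mono => y; apply: fp_step_mono.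
Qed.

(* Full, Down and DownLt are the two-headed arrow, the down harpoon, and the
   down harpoon marked <. *)
Variant arrow := Full | Down | DownLt.

(* Proof trees, finite or infinite, with conclusion (k, s, t).
   The rules are stated with equations rather than as an indexed family so that
   trees can be analysed without dependent inversion. *)
CoInductive ptree (k : arrow) (s t : T) : Type :=
| Split (n : nat) (u : 'I_n.+1 -> T) of k = Full & u ord0 = s &
    (forall i : 'I_n,
       root_step (u (widen_ord (leqnSn n) i)) (u (lift ord0 i)) +
       ptree DownLt (u (widen_ord (leqnSn n) i)) (u (lift ord0 i))) &
    ptree Down (u ord_max) t
| Lift (f : Sig) (a b : 'I_(arity f) -> T) of k = Down \/ k = DownLt &
    s = app f a & t = app f b & (forall i, ptree Full (a i) (b i))
| Id of k = Down \/ k = DownLt & s = t.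

Record node := Node {
  node_arrow : arrow;
  node_lhs : T;
  node_rhs : T;
  node_tree :> ptree node_arrow node_lhs node_rhs }.

(* w is the subtree above v rooted at one of the premises of the last rule of v;
   root steps are leaves, not nodes. *)
Definition premise (v w : node) : Prop :=
  match node_tree v with
  | Split _ _ _ _ steps last =>
      (exists i d, steps i = inr d /\ w = Node d) \/ w = Node last
  | Lift _ _ _ _ _ _ args => exists i, w = Node (args i)
  | Id _ _ => False
  end.

Definition ascending_path (v : node) (p : nat -> node) : Prop :=
  p 0 = v /\ forall m, premise (p m) (p m.+1).

Definition meets_infinitely_many_DownLt (p : nat -> node) : Prop :=
  forall N, exists2 m, N <= m & node_arrow (p m) = DownLt.

Definition rewrites_nest : relation T :=
  fun s t => exists d : ptree Full s t,
    forall p, ascending_path (Node d) p -> ~ meets_infinitely_many_DownLt p.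

End Rewriting.

(* Main.v *)
(** For [fp] included in [nest]: [nest] is a pre-fixed point of the outer map.
    A post-fixed point [P] of the inner map unfolds to a proof tree whose spine
    alternates between [Full] and [Down] nodes, with well-nested trees hanging
    off it; a path either stays on the spine, where no [DownLt] node occurs, or
    enters one of those trees.

    For [nest] included in [fp]: if the conclusion of a tree is not in [fp], then
    coinduction for the inner fixed point yields a reachable [DownLt] node with a
    premise whose conclusion is again not in [fp].  Iterating gives a path that
    meets infinitely many [DownLt] nodes. *)
From mathcomp Require Import all_boot.
Require Import Defs.
From Stdlib Require Import Relations ClassicalEpsilon ChoiceFacts.

Set Implicit Arguments.
Unset Strict Implicit.
Unset Printing Implicit Defensive.

Section Chains.
Variables (A : Type) (Q : relation A).

(** Bridges the closure in [fp_step] and the ordinal-indexed sequence taken by [Split];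
    [chain_clos_rt] is the way back. *)
Lemma clos_rt_chain s t : clos_refl_trans A Q s t ->
  exists n (u : 'I_n.+1 -> A), [/\ u ord0 = s, u ord_max = t &
    forall i : 'I_n, Q (u (widen_ord (leqnSn n) i)) (u (lift ord0 i))].
Proof.
move=> st; suff [n [u [u0 un Qu]]] : exists n (u : nat -> A),
    [/\ u 0 = s, u n = t & forall i, i < n -> Q (u i) (u i.+1)].
  by exists n, (fun i => u i); split=> [||i] //; exact: Qu (ltn_ord i).
elim: (clos_rt_rt1n _ _ _ _ st) => {s t st} [t|s v t sv _ [n [u [u0 un Qu]]]].
  by exists 0, (fun=> t).
exists n.+1, (fun i => if i is j.+1 then u j else s).
by split=> // -[_|i lt_i]; [rewrite u0 | apply: Qu].
Qed.

Lemma chain_clos_rt n (u : 'I_n.+1 -> A) :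
  (forall i : 'I_n, Q (u (widen_ord (leqnSn n) i)) (u (lift ord0 i))) ->
  clos_refl_trans A Q (u ord0) (u ord_max).
Proof.
elim: n u => [|n IHn] u Qu.
  by rewrite (_ : ord_max = ord0); [apply: rt_refl | apply: val_inj].
apply: rt_trans (u (lift ord0 ord0)) _ _ _.
  by rewrite (_ : ord0 = widen_ord (leqnSn n.+1) ord0);
     [apply/rt_step/Qu | apply: val_inj].
have := IHn (u \o lift ord0) => /=.
rewrite (_ : lift ord0 ord_max = ord_max); last exact: val_inj.
apply=> i; have := Qu (lift ord0 i).
by congr (Q (u _) _); apply: val_inj.
Qed.

End Chains.

Section Nesting.
Variables (Sig : signature) (X : Type) (R : trs Sig X).
Notation T := (term Sig X).

Definition well_nested (v : node R) : Prop :=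
  forall p, ascending_path v p -> ~ meets_infinitely_many_DownLt p.

(** A path that leaves [S] has a tail in a well-nested tree, and that tail would inherit the
    infinitely many [DownLt] nodes; a path that stays in [S] meets none. *)
Lemma well_nested_spine (S : node R -> Prop) :
  (forall v, S v -> node_arrow v <> DownLt) ->
  (forall v w, S v -> premise v w -> S w \/ well_nested w) ->
  forall v, S v -> well_nested v.
Proof.
move=> SnLt Sprem v Sv p [p0 pS] infp.
have Sp m : S (p m).
  elim: m => [|m IHm]; first by rewrite p0.
  case: (Sprem _ _ IHm (pS m)) => // wn.
  case: (wn (fun i => p (m.+1 + i))) => [|N].
    by split=> [|i]; rewrite ?addn0 // addnS; apply: pS.
  (* Searching from [m.+1 + N] leaves an index of at least [N] after the shift by [m.+1]. *)
  have [i le_i Lt_i] := infp (m.+1 + N).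
  exists (i - m.+1); first by rewrite leq_subRL // (leq_trans _ le_i) ?leq_addr.
  by rewrite subnKC // (leq_trans _ le_i) ?leq_addr.
by have [m _] := infp 0; apply: SnLt.
Qed.

Lemma well_nested_premises (v : node R) :
  (forall w, premise v w -> well_nested w) -> well_nested v.
Proof.
move=> wnv p [p0 pS] infp; apply: (wnv (p 1) _ (fun i => p i.+1)).
- by rewrite -p0.
- by split=> // m; apply: pS.
move=> N; have [[|m] // le_m Lt_m] := infp N.+1.
by exists m.
Qed.

(** Choice selects one well-nested tree per argument; the new root adds a single [DownLt] node to
    each path. *)
Lemma lifting_well_nested s t : lifting (rewrites_nest R) s t ->
  exists d : ptree R DownLt s t, well_nested (Node d).
Proof.
case=> [f a b ab|u]; last first.
  by exists (Id R (or_intror erefl) erefl); apply: well_nested_premises.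
pose d i := constructive_indefinite_description _ (ab i).
exists (Lift (or_intror erefl) erefl erefl (fun i => sval (d i))).
by apply: well_nested_premises => w [i ->]; apply: (svalP (d i)).
Qed.

Section Unfolding.
Variable P : relation T.
Hypothesis Ppost : inclusion T P (fp_step R (rewrites_nest R) P).

(* [lifting P] and the layers of [fp_step], in [Type] so that the corecursive
   definition below can analyse them. *)
Variant lift_layer (s t : T) : Type :=
| LayerLift f (a b : 'I_(arity f) -> T) of s = app f a & t = app f b &
    (forall i, P (a i) (b i))
| LayerId of s = t.

Variant layer (s t : T) : Type :=
| Layer n (u : 'I_n.+1 -> T) of u ord0 = s &
    (forall i : 'I_n,
       root_step R (u (widen_ord (leqnSn n) i)) (u (lift ord0 i)) +
       {d : ptree R DownLt (u (widen_ord (leqnSn n) i)) (u (lift ord0 i))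
         | well_nested (Node d)}) &
    lift_layer (u ord_max) t.

Lemma layer_inhabited s t : P s t -> inhabited (layer s t).
Proof.
move=> st; have [w sw wt] := Ppost st.
have [n [u [u0 un Qu]]] := clos_rt_chain sw.
have {wt} [last] : inhabited (lift_layer (u ord_max) t).
  rewrite un; case: wt => [f a b ab|v]; constructor; last exact: LayerId.
  exact: LayerLift ab.
have steps i : inhabited
    (root_step R (u (widen_ord (leqnSn n) i)) (u (lift ord0 i)) +
     {d : ptree R DownLt (u (widen_ord (leqnSn n) i)) (u (lift ord0 i))
       | well_nested (Node d)}).
  case: (Qu i) => [?|/lifting_well_nested [d wnd]]; constructor; first by left.
  by right; exists d.
constructor; apply: Layer u0 _ last => i.
exact: epsilon (steps i) (fun=> True).
Qed.

Definition layer_of s t (st : P s t) : layer s t :=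
  epsilon (layer_inhabited st) (fun=> True).

(** Each corecursive call is guarded by a [Split] and a [Lift]. The [or_introl] gives the spine the
    arrow [Down], not [DownLt]. *)
CoFixpoint unfold_tree s t (st : P s t) : ptree R Full s t :=
  match layer_of st with
  | Layer _ u u0 steps last =>
    Split erefl u0
      (fun i => match steps i with
                | inl r => inl r
                | inr d => inr (sval d)
                end)
      (match last with
       | LayerLift _ _ _ es et ab =>
           Lift (or_introl erefl) es et (fun i => unfold_tree (ab i))
       | LayerId e => Id R (or_introl erefl) e
       end)
  end.

Definition unfolded (v : node R) : Prop :=
  exists s t (st : P s t), v = Node (unfold_tree st).

Lemma unfold_tree_well_nested s t (st : P s t) :
  well_nested (Node (unfold_tree st)).
Proof.
(* The spine consists of the unfolded [Full] nodes and of the [Down] nodes between them, the latter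
   described through their premises. *)
apply: (well_nested_spine (S := fun v => unfolded v \/
  node_arrow v = Down /\ forall w, premise v w -> unfolded w)); last first.
- by left; exists s, t, st.
- move=> v w [[s' [t' [st' ->]]]|[_ vw] /vw]; last by left; left.
  rewrite /premise /=; case: (layer_of st') => n u u0 steps last /=.
  case=> [[i [d [ed ->]]]|->].
    by right; case: (steps i) ed => // -[d' wnd'] [<-].
  left; right; split=> // w'; case: last => //= f a b es et ab [i ->].
  by exists (a i), (b i), (ab i).
- by move=> v [[s' [t' [st' ->]]]|[->]].
Qed.

End Unfolding.

Lemma rewrites_fp_nest : inclusion T (rewrites_fp R) (rewrites_nest R).
Proof.
(* [mu] is the intersection of all pre-fixed points, so it remains to show that [rewrites_nest R] is
   one. *)
move=> s t; apply=> {}s {}t [P Ppost st].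
by exists (unfold_tree Ppost st); apply: unfold_tree_well_nested.
Qed.

Definition unsound (v : node R) : Prop :=
  node_arrow v = Full /\ ~ rewrites_fp R (node_lhs v) (node_rhs v).

(** The distance [k] is explicit so that a path can later be built premise by premise along a
    decreasing counter. *)
Fixpoint reaches_unsound (k : nat) (v : node R) : Prop :=
  if k is k'.+1 then exists2 w, premise v w & reaches_unsound k' w
  else node_arrow v = DownLt /\ exists2 w, premise v w & unsound w.

Lemma DownLt_lifting s t (d : ptree R DownLt s t) :
  ~ reaches_unsound 0 (Node d) -> lifting (rewrites_fp R) s t.
Proof.
case: d => [//|f a b ek es et args|? e] nd; last by rewrite e; apply: lifting_id.
rewrite es et; apply: lifting_app => i; apply: NNPP => nab; apply: nd; split=> //.
by exists (Node (args i)); first by exists i.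
Qed.

Lemma unsound_reaches v : unsound v -> exists k, reaches_unsound k v.
Proof.
case: v => k s t d [/= ek]; subst k => nst; apply: NNPP => nd; apply: nst.
case: (rewrites_fp_outer R) => -[pre _] _; apply: pre.
(* The post-fixed point for the inner map: conclusions of [Full] trees from which no [DownLt] node
   with an unsound premise is reachable. *)
exists (fun s t => exists d : ptree R Full s t,
  ~ exists k, reaches_unsound k (Node d)); last by exists d.
move=> {d nd} s' t' [[n u efull u0 steps last|f a b []//|[]//] nd].
have ndP k w : premise (Node (Split efull u0 steps last)) w ->
    ~ reaches_unsound k w.
  by move=> vw kw; apply: nd; exists k.+1, w.
exists (u ord_max).
  rewrite -u0; apply: chain_clos_rt => i.
  case ei: (steps i) => [st|d]; [by left | right].
  by apply: (DownLt_lifting (d := d)); apply: ndP; left; exists i, d.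
have {ndP} : forall k, ~ reaches_unsound k (Node last) by move=> k; apply: ndP; right.
case: last {nd} => [//|f a b ? es et args|? e] nd; last by rewrite e; apply: lifting_id.
rewrite es et; apply: lifting_app => i; exists (args i) => -[k kd].
by apply: (nd k.+1); exists (Node (args i)); first by exists i.
Qed.

Lemma rewrites_nest_fp : inclusion T (rewrites_nest R) (rewrites_fp R).
Proof.
move=> s t [d wnd]; apply: NNPP => nst.
have [k0 k0d] : exists k, reaches_unsound k (Node d) by apply: unsound_reaches.
(* A state [(k, v)] counts down the steps from [v] to the next [DownLt] node. *)
pose next (x y : nat * node R) := reaches_unsound x.1 x.2 ->
  [/\ premise x.2 y.2, reaches_unsound y.1 y.2 &
      if x.1 is k.+1 then y.1 = k else node_arrow x.2 = DownLt].
have nextP x : exists y, next x y.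
  (* Outside the reachable states [next] holds vacuously, so it is total, as dependent choice
     requires. *)
  case: (classic (reaches_unsound x.1 x.2)) => [|nx]; last by exists x => /nx.
  case: x => -[|k] v /= => [[Ltv [w vw /unsound_reaches [k kw]]]|[w vw kw]].
    by exists (k, w).
  by exists (k, w).
have [p [p0 pS]] : exists p, p 0 = (k0, Node d) /\ forall m, next (p m) (p m.+1).
  apply: functional_choice_imp_functional_dependent_choice nextP _ => A B Q QP.
  exists (fun x => sval (constructive_indefinite_description _ (QP x))) => x.
  exact: svalP.
have pr m : reaches_unsound (p m).1 (p m).2.
  by elim: m => [|m /pS []]; first by rewrite p0.
apply: (wnd (fun m => (p m).2)) => [|N].
  by split=> [|m]; [rewrite p0 | case: (pS m (pr m))].
(* Induction on the counter at [N]: when it hits zero, the current node is a [DownLt] node at or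
   after [N]. *)
move ek: (p N).1 => k; elim: k N ek => [|k IHk] N ek;
  have [_ _] := pS N (pr N); rewrite ek => eS; first by exists N.
by have [m lt_m Lt_m] := IHk N.+1 eS; exists m => //; apply: ltnW.
Qed.

End Nesting.

Theorem theorem3 (Sig : signature) (X : Type) (hX : infinite X)
    (R : trs Sig X) :
  same_relation (term Sig X) (rewrites_nest R) (rewrites_fp R).
Proof. by split; [apply: rewrites_nest_fp | apply: rewrites_fp_nest]. Qed.
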